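(* For all $v\in V$, the virtual link $\mathscr{L}_V(v)$ is checkerboard colorable.
   Context: **Thompson's group $V$.** All trees are finite planar rooted binary trees (each non-leaf vertex has a left child and a right child); leaves are numbered from left to right. A tree with $n$ leaves determines a partition of $[0,1)$ into $n$ half-open standard dyadic intervals by repeated halving. A triple $(T_+,T_-,\sigma)$, where $T_+,T_-$ are trees with the same number $n$ of leaves and $\sigma\in S_n$, represents the bijection of $[0,1)$ mapping, affinely and increasingly, the $i$-th interval of $T_+$ onto the $\sigma(i)$-th interval of $T_-$. Thompson's group $V$ is the group of all such bijections under composition. Adding a canceling caret to a triple means: for some $i$, attach a caret (two new leaf children) to the $i$-th leaf of $T_+$ and to the $\sigma(i)$-th leaf of $T_-$, and change $\sigma$ to the permutation matching the new left leaf with the new left leaf, the new right leaf with the new right leaf, and all other leaves as before. Two triples represent the same element iff they are related by adding/removing canceling carets; a triple is reduced if no canceling caret can be removed, and each element of $V$ has a unique reduced triple. **Virtual links.** A virtual link diagram is a link diagram in $\mathbb{R}^2$ each of whose crossings is marked as a classical over/under crossing or as a virtual crossing. Two are equivalent if related by a finite sequence of planar isotopies, classical Reidemeister moves, and detour moves (a portion of an arc containing only virtual crossings may be rerouted arbitrarily, with all new crossings virtual). A link diagram on a closed oriented surface $\Sigma$ represents a virtual link type (immerse a neighborhood of the diagram in the plane preserving orientation, marking the extra crossings as virtual). A virtual link is checkerboard colorable if its type can be represented by a diagram $D$ on some closed oriented surface $\Sigma$ with $[D]=0\in H_1(\Sigma;\mathbb{Z}_2)$; equivalently, the components of $\Sigma\smallsetminus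 D$ can be shaded in two colors so that every edge of $D$ borders a component of each color. **The diagram $\mathscr{L}_V(T_+,T_-,\sigma)$.** Let $T$ be a tree with $n$ leaves drawn growing downward. At each non-leaf vertex add a middle edge between its two child edges, running down to the leaf level in the gap between the leaves of the left subtree and those of the right subtree; also attach an edge to the root going up and then around the left side of the tree down to the leaf level. Each non-leaf vertex of $T$ is now 4-valent (up, left, middle, right edges); replace it by a classical crossing in which the strand consisting of the left and right edges passes over the strand consisting of the up and middle edges. This gives a tangle with $2n$ endpoints at the leaf level. Checkerboard-shade it with the outside face unshaded; for each $i=1,\dots,n$ the shaded surface reaches the leaf level in one band, namely the one bounded by the $(2i-1)$-st and $2i$-th strands (the $i$-th leaf edge and the strand immediately to its left). Do this for $T_+$; do it for $T_-$ and reflect the result in a horizontal line of the plane (the left-right strand is still over at each crossing), placing it below. Join the $i$-th band of the top surface to the $\sigma(i)$-th band of the bottom surface by flat untwisted bands, for all $i$, with all intersections of distinct bands marked as virtual crossings. The boundary of the resulting surface is the virtual link diagram $\mathscr{L}_V(T_+,T_-,\sigma)$; it is well-defined up to detour moves. For $v\in V$, $\mathscr{L}_V(v)$ denotes $\mathscr{L}_V(T_+,T_-,\sigma)$ for the reduced triple of $v$. *)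

(* Defs.v *)
From Stdlib Require Import Relations.
From mathcomp Require Import all_boot all_order all_algebra all_fingroup.
From mathcomp Require Import reals.
From mathcomp Require Import zify.

Set Implicit Arguments.
Unset Strict Implicit.
Unset Printing Implicit Defensive.

Import Order.TTheory GRing.Theory Num.Theory.

(** * Thompson's group V *)

Inductive tree := Leaf | Node of tree & tree.

Fixpoint nleaves (T : tree) : nat :=
  if T is Node l r then nleaves l + nleaves r else 1.

(* Leaves are numbered from 0, left to right. *)
Fixpoint add_caret (T : tree) (k : nat) : tree :=
  match T with
  | Leaf => Node Leaf Leaf
  | Node l r => if k < nleaves l then Node (add_caret l k) r
                else Node l (add_caret r (k - nleaves l))
  end.

Record triple := Triple {
  size3 : nat;
  top_tree : tree;
  bot_tree : tree;
  top_leaves : nleaves top_tree = size3;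
  bot_leaves : nleaves bot_tree = size3;
  sigma : 'S_size3
}.

(* [t'] is [t] with a canceling caret added at leaf [i].  An old leaf [j] of a
   tree that receives a caret at leaf [k] becomes leaf [bump k.+1 j], i.e. [j]
   if [j <= k] and [j.+1] otherwise; leaf [k] itself is replaced by the new
   left leaf [k] and the new right leaf [k.+1]. *)
Definition adds_canceling_caret (t t' : triple) (i : 'I_(size3 t)) : Prop :=
  [/\ top_tree t' = add_caret (top_tree t) i,
      bot_tree t' = add_caret (bot_tree t) (sigma t i),
      forall (j : 'I_(size3 t)) (j' : 'I_(size3 t')),
        j' = bump i.+1 j :> nat ->
        sigma t' j' = bump (sigma t i).+1 (sigma t j) :> nat
    & forall j' : 'I_(size3 t'),
        j' = i.+1 :> nat -> sigma t' j' = (sigma t i).+1 :> nat].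

Definition reduced (t' : triple) : Prop :=
  ~ exists (t : triple) (i : 'I_(size3 t)), adds_canceling_caret t' i.

Section ThompsonV.
Local Open Scope ring_scope.
Variable R : realType.

Definition I01 := {x : R | 0 <= x < 1}.

(* Endpoints of the half-open intervals into which [T] divides [a, b). *)
Fixpoint intervals (T : tree) (a b : R) : seq (R * R) :=
  match T with
  | Leaf => [:: (a, b)]
  | Node l r => intervals l a ((a + b) / 2) ++ intervals r ((a + b) / 2) b
  end.

Definition interval (T : tree) (i : nat) : R * R :=
  nth (0, 0) (intervals T 0 1) i.

Definition represents (t : triple) (v : I01 -> I01) : Prop :=
  forall (i : 'I_(size3 t)) (x : I01),
    let: (a, b) := interval (top_tree t) i in
    let: (c, d) := interval (bot_tree t) (sigma t i) in
    a <= val x < b -> val (v x) = c + (val x - a) * ((d - c) / (b - a)).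

Record thompsonV := ThompsonV {
  thompson_map :> I01 -> I01;
  thompson_mapP : exists t, represents t thompson_map
}.

Definition is_reduced_triple_of (t : triple) (v : thompsonV) : Prop :=
  represents t v /\ reduced t.

End ThompsonV.

(** * Virtual link diagrams *)

(* A diagram in the plane, in general position with respect to the height
   function, is read from top to bottom as a word.  Each letter [(g, i)]
   contains one maximum, minimum or crossing, with exactly [i] vertical
   strands to the left of it. *)

(* [OverL]: the strand through the upper left end is over;
   [OverR]: the strand through the upper right end is over. *)
Inductive kind := OverL | OverR | Virt.

(* [Cap] is a local maximum, [Cup] a local minimum. *)
Inductive gen := Cap | Cup | Cross of kind.

Definition word := seq (gen * nat).

Definition ins (g : gen) := if g is Cap then 0 else 2.
Definition outs (g : gen) := if g is Cup then 0 else 2.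

(* The number of strands below [w] when there are [m] above it. *)
Fixpoint run (m : nat) (w : word) : option nat :=
  if w is (g, i) :: w' then
    if i + ins g <= m then run (m - ins g + outs g) w' else None
  else Some m.

Record vdiagram := VDiagram {
  vword :> word;
  vword_closed : run 0 vword = Some 0
}.

(* Reflection in a horizontal line exchanges these kinds, if the strand that
   is over remains over. *)
Definition opp (k : kind) : kind :=
  match k with OverL => OverR | OverR => OverL | Virt => Virt end.

Inductive planar_isotopy : word -> word -> Prop :=
| iso_exchange g h i d :
    planar_isotopy [:: (g, i); (h, i + outs g + d)]
                   [:: (h, i + ins g + d); (g, i)]
| iso_zigzag_l i : planar_isotopy [:: (Cap, i); (Cup, i.+1)] [::]
| iso_zigzag_r i : planar_isotopy [:: (Cap, i.+1); (Cup, i)] [::]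
| iso_slide_cup k i :
    planar_isotopy [:: (Cross k, i); (Cup, i.+1)]
                   [:: (Cross (opp k), i.+1); (Cup, i)]
| iso_slide_cap k i :
    planar_isotopy [:: (Cap, i); (Cross k, i.+1)]
                   [:: (Cap, i.+1); (Cross (opp k), i)].

(* In [R3] the condition on [k1], [k2], [k3] says that the three strands lie at
   three different heights. *)
Inductive reidemeister : word -> word -> Prop :=
| R1 k i : k <> Virt ->
    reidemeister [:: (Cap, i); (Cross k, i)] [:: (Cap, i)]
| R2 k i : k <> Virt ->
    reidemeister [:: (Cross k, i); (Cross (opp k), i)] [::]
| R3 k1 k2 k3 i : k1 <> Virt -> k2 <> Virt -> k3 <> Virt ->
    (k1 = k3 -> k2 = k1) ->
    reidemeister
      [:: (Cross k1, i); (Cross k2, i.+1); (Cross k3, i)]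
      [:: (Cross k3, i.+1); (Cross k2, i); (Cross k1, i.+1)].

(* What is left of a diagram when an arc is cut out of it: a word together
   with the places where the arc was cut off, either from a strand coming from
   above ([CutAbove]) or from a strand going down ([CutBelow]); positions count
   only the strands that are left. *)
Inductive item := Rest of gen * nat | CutAbove of nat | CutBelow of nat.

Definition is_cut (x : item) := if x is Rest _ then false else true.

(* [drawn s E w]: below a level with strands [s], the word [w] is obtained from
   [E] by drawing in curves that have only virtual crossings.  In [s], [None]
   is a strand of [E], and [Some l] belongs to the curves drawn in; two of the
   latter have the same label iff they have been joined above that level.  No
   curve drawn in is allowed to close up ([a != b] in [drawn_arc_cup]). *)
Inductive drawn : seq (option nat) -> seq item -> word -> Prop :=
| drawn_nil : drawn [::] [::] [::]
| drawn_cap s1 s2 E w :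
    drawn (s1 ++ [:: None; None] ++ s2) E w ->
    drawn (s1 ++ s2)
          (Rest (Cap, count_mem None s1) :: E) ((Cap, size s1) :: w)
| drawn_cup s1 s2 E w :
    drawn (s1 ++ s2) E w ->
    drawn (s1 ++ [:: None; None] ++ s2)
          (Rest (Cup, count_mem None s1) :: E) ((Cup, size s1) :: w)
| drawn_cross k s1 s2 E w :
    drawn (s1 ++ [:: None; None] ++ s2) E w ->
    drawn (s1 ++ [:: None; None] ++ s2)
          (Rest (Cross k, count_mem None s1) :: E) ((Cross k, size s1) :: w)
| drawn_arc_cap l s1 s2 E w : Some l \notin s1 ++ s2 ->
    drawn (s1 ++ [:: Some l; Some l] ++ s2) E w ->
    drawn (s1 ++ s2) E ((Cap, size s1) :: w)
| drawn_arc_cup a b s1 s2 E w : a != b ->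
    drawn [seq if x == Some b then Some a else x | x <- s1 ++ s2] E w ->
    drawn (s1 ++ [:: Some a; Some b] ++ s2) E ((Cup, size s1) :: w)
| drawn_arc_virtual x y s1 s2 E w : ~~ ((x == None) && (y == None)) ->
    drawn (s1 ++ [:: y; x] ++ s2) E w ->
    drawn (s1 ++ [:: x; y] ++ s2) E ((Cross Virt, size s1) :: w)
| drawn_cut_above l s1 s2 E w : Some l \notin s1 ++ s2 ->
    drawn (s1 ++ Some l :: s2) E w ->
    drawn (s1 ++ None :: s2) (CutAbove (count_mem None s1) :: E) w
| drawn_cut_below l s1 s2 E w :
    drawn (s1 ++ None :: s2) E w ->
    drawn (s1 ++ Some l :: s2) (CutBelow (count_mem None s1) :: E) w.

(* As there are two cuts and no closed curve is drawn in, what is drawn in is a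
   single arc. *)
Definition detour (w w' : word) : Prop :=
  exists E, [/\ count is_cut E = 2, drawn [::] E w & drawn [::] E w'].

Inductive move (D D' : vdiagram) : Prop :=
| move_local u a b v :
    planar_isotopy a b \/ reidemeister a b ->
    vword D = u ++ a ++ v -> vword D' = u ++ b ++ v -> move D D'
| move_detour : detour D D' -> move D D'.

Definition vequiv : relation vdiagram := clos_refl_sym_trans vdiagram move.

(** * Diagrams on closed oriented surfaces *)

(* A link diagram on a closed oriented surface, up to homeomorphism.  The darts
   are the half-edges of the diagram, subdivided by 2-valent vertices so that
   each component has a vertex; [edge] exchanges the two halves of an edge, and
   [node] turns counterclockwise around a vertex.  The regions are the
   components of the complement: [side d] is the one to the left of [d] when
   looking away from the vertex, and [genus] is its genus as a surface with
   boundary.  The complement need not consist of discs, and the surface need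
   not be connected. *)
Record surface_diagram := SurfaceDiagram {
  dart : finType;
  edge : dart -> dart;
  edgeK : involutive edge;
  edge_neq : forall d, edge d != d;
  node : dart -> dart;
  node4 : forall d, iter 4 node d = d;
  node_neq : forall d, node d != d;
  over : pred dart;
  over_node : forall d, node (node d) != d -> over (node d) = ~~ over d;
  region : finType;
  side : dart -> region;
  side_edge : forall d, side (edge (node d)) = side d;
  genus : region -> nat
}.

Definition checkerboard (S : surface_diagram) : Prop :=
  exists shaded : region S -> bool,
    forall d : dart S, shaded (side d) != shaded (side (edge d)).

(* The darts of a planar diagram at the letter number [t] are the [(t, k)]:
   [k = 0, 1, 2, 3] for the upper left, lower left, lower right, upper right
   end of a classical crossing (the counterclockwise order), and [k = 0, 1]
   for the left and right leg of a [Cap], which is a 2-valent vertex.  Virtual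
   crossings and [Cup]s are not vertices. *)
Definition wdart := (nat * nat)%type.

Definition valence (g : gen) : nat :=
  match g with Cap => 2 | Cup | Cross Virt => 0 | Cross _ => 4 end.

Definition wgen (w : word) (t : nat) : gen := (nth (Cup, 0) w t).1.

Definition wdarts (w : word) : seq wdart :=
  [seq (t, k) | t <- iota 0 (size w), k <- iota 0 (valence (wgen w t))].

Definition wnode (w : word) (d : wdart) : wdart :=
  (d.1, d.2.+1 %% valence (wgen w d.1)).

Definition wover (w : word) (d : wdart) : bool :=
  match wgen w d.1 with
  | Cross OverL => ~~ odd d.2
  | Cross OverR => odd d.2
  | _ => false
  end.

(* The edges of the rest [w] of a diagram, starting with letter number [t],
   when the strands above it end in the darts [s]. *)
Fixpoint trace (t : nat) (s : seq wdart) (w : word) : seq (wdart * wdart) :=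
  if w is (g, i) :: w' then
    let l := take i s in
    let x := nth (0, 0) s i in
    let y := nth (0, 0) s i.+1 in
    let r := drop (i + ins g) s in
    match g with
    | Cap => trace t.+1 (l ++ [:: (t, 0); (t, 1)] ++ r) w'
    | Cup => (x, y) :: trace t.+1 (l ++ r) w'
    | Cross Virt => trace t.+1 (l ++ [:: y; x] ++ r) w'
    | Cross _ => [:: (x, (t, 0)); (y, (t, 3))] ++
                 trace t.+1 (l ++ [:: (t, 1); (t, 2)] ++ r) w'
    end
  else [::].

Definition wedges (w : word) : seq (wdart * wdart) := trace 0 [::] w.

(* [D] is obtained from [S] by immersing a neighborhood of the diagram [S] in
   the plane, preserving the orientation, and marking the extra crossings as
   virtual. *)
Definition immersed_as (S : surface_diagram) (D : vdiagram) : Prop :=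
  exists f : wdart -> dart S,
    [/\ {in wdarts D &, injective f},
        forall d, exists2 x, x \in wdarts D & f x = d,
        {in wdarts D, forall x, f (wnode D x) = node (f x)},
        {in wdarts D, forall x, valence (wgen D x.1) = 4 ->
                                over (f x) = wover D x}
      & forall x y, (x, y) \in wedges D -> edge (f x) = f y].

Definition surface_represents (S : surface_diagram) (D : vdiagram) : Prop :=
  exists2 D' : vdiagram, vequiv D D' & immersed_as S D'.

Definition checkerboard_colorable (D : vdiagram) : Prop :=
  exists2 S : surface_diagram, surface_represents S D & checkerboard S.

(** * The diagram of a triple *)

(* [tree_word T i] turns the strand number [i], which is the edge going up from
   the root of [T], into the [2 * nleaves T - 1] strands at the leaf level: the
   leaf edges alternate with the middle edges in the gaps.  At a vertex the
   left and right edges form a [Cap], whose right leg passes over the up-middle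
   strand. *)
Fixpoint tree_word (T : tree) (i : nat) : word :=
  match T with
  | Leaf => [::]
  | Node l r => [:: (Cap, i); (Cross OverL, i.+1)] ++
                tree_word l i ++ tree_word r (i + 2 * nleaves l)
  end.

(* The initial [Cap] takes the edge at the root to the left of the tree. *)
Definition top_word (T : tree) : word := (Cap, 0) :: tree_word T 1.

Definition flip_gen (g : gen) : gen :=
  match g with Cap => Cup | Cup => Cap | Cross k => Cross (opp k) end.

Definition flip (w : word) : word :=
  rev [seq (flip_gen x.1, x.2) | x <- w].

(* Band number [j] consists of the strands [2 * j] and [2 * j + 1]; it is
   crossed with the next band. *)
Definition band_crossing (j : nat) : word :=
  [seq (Cross Virt, i) | i <- [:: (2 * j).+1; 2 * j; (2 * j).+2; (2 * j).+1]].

(* [s] lists the destinations of the bands from number [j] on, relative to each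
   other: they are sorted by increasing destination. *)
Fixpoint route (j : nat) (s : seq nat) : word :=
  if s is x :: s' then
    route j.+1 s' ++
    flatten [seq band_crossing k | k <- iota j (count (fun y => y < x) s')]
  else [::].

Definition LV_word (t : triple) : word :=
  top_word (top_tree t) ++
  route 0 [seq val (sigma t i) | i <- enum 'I_(size3 t)] ++
  flip (top_word (bot_tree t)).

Lemma run_cat m w1 w2 : run m (w1 ++ w2) = obind (run^~ w2) (run m w1).
Proof. by elim: w1 m => [|[g i] w1 IH] m //=; case: ifP. Qed.

Lemma nleaves_gt0 T : 0 < nleaves T.
Proof. by elim: T => //= l IHl r IHr; lia. Qed.

Lemma run_tree T i m : i < m ->
  run m (tree_word T i) = Some (m + 2 * (nleaves T).-1).
Proof.
elim: T i m => [|l IHl r IHr] i m im /=; first by rewrite muln0 addn0.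
have := nleaves_gt0 l; have := nleaves_gt0 r => r0 l0.
rewrite addn0 (ltnW im) ifT; last by lia.
rewrite run_cat IHl /=; last by lia.
by rewrite IHr; [congr Some; lia | lia].
Qed.

Lemma run_top T : run 0 (top_word T) = Some (2 * nleaves T).
Proof.
by rewrite /top_word /= run_tree //; congr Some; have := nleaves_gt0 T; lia.
Qed.

Lemma run_flip m n w : run m w = Some n -> run n (flip w) = Some m.
Proof.
rewrite /flip; elim: w m => [|[g i] w IH] m /=; first by move=> [->].
case: ifP => // im /IH e; rewrite rev_cons -cats1 run_cat e /=.
case: g im {e} => [||k] /= im; rewrite ifT; try lia; congr Some; lia.
Qed.

Lemma run_band m j : 2 * j.+2 <= m -> run m (band_crossing j) = Some m.
Proof. by move=> jm; rewrite /= !ifT; [congr Some; lia | lia..]. Qed.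

Lemma run_bands m j c : 2 * (j + c).+1 <= m ->
  run m (flatten [seq band_crossing k | k <- iota j c]) = Some m.
Proof.
elim: c j => [|c IH] j jm //.
rewrite -[flatten _]/(band_crossing j ++
                      flatten [seq band_crossing k | k <- iota j.+1 c]).
rewrite run_cat run_band; last by lia.
by apply: IH; lia.
Qed.

Lemma run_route m j s : 2 * (j + size s) <= m -> run m (route j s) = Some m.
Proof.
elim: s j => [|x s IH] j //= jm.
have := count_size (fun y => y < x) s => cs.
rewrite run_cat IH; last by lia.
by rewrite [obind _ _]/= run_bands //; lia.
Qed.

Lemma LV_word_closed t : run 0 (LV_word t) = Some 0.
Proof.
rewrite /LV_word run_cat run_top [obind _ _]/= run_cat run_route; last first.
  by rewrite size_map size_enum_ord top_leaves.
by apply: run_flip; rewrite run_top bot_leaves top_leaves.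
Qed.

Definition LV (t : triple) : vdiagram := VDiagram (LV_word_closed t).

(* Main.v *)
Require Import Defs.
From mathcomp Require Import all_boot all_order all_algebra all_fingroup.
From mathcomp Require Import reals.
From mathcomp Require Import zify.

Set Implicit Arguments.
Unset Strict Implicit.
Unset Printing Implicit Defensive.

(** Shade the plane so that, at each level, the area with [p] strands to its
    left is shaded iff [p] is odd.  Caps, cups and classical crossings respect
    this rule, and so does a virtual crossing of two bands, as each of them
    shifts by two positions.  Hence the darts of the diagram are coloured
    so that the colour alternates around each vertex and along each edge.
    Gluing one shaded and one unshaded region to the neighbourhood of the
    diagram, along all boundary circles of the respective colour, gives a
    checkerboard coloured surface diagram. *)

Lemma nth_cat_size T x0 (s1 s2 : seq T) x :
  nth x0 (s1 ++ x :: s2) (size s1) = x.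
Proof. by rewrite nth_cat ltnn subnn. Qed.

Lemma split2 T (s : seq T) i : i + 2 <= size s ->
  exists l x y r, s = l ++ [:: x, y & r] /\ size l = i.
Proof.
move=> si; exists (take i s).
case e : (drop i s) (size_drop i s) => [|x [|y r]] /= sr; [lia | lia |].
by exists x, y, r; rewrite -e cat_take_drop size_take ifT //; lia.
Qed.

(** * Involutions given by lists of pairs *)

Section Matching.
Variable T : eqType.
Implicit Types (es : seq (T * T)) (x y : T) (c : T -> bool).

Definition ends es : seq T := flatten [seq [:: e.1; e.2] | e <- es].

(** This turns an edge list into the edge involution of a surface diagram; it is an involution on
    [ends es] once no element occurs there twice. *)
Fixpoint partner es x : T :=
  if es is (a, b) :: es' then
    if x == a then b else if x == b then a else partner es' x
  else x.

Lemma partner_mem es x : x \in ends es -> partner es x \in ends es.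
Proof.
elim: es => [|[a b] es IH] //=; rewrite /ends /= -/(ends es) !inE.
by case: eqP => [_|_]; [rewrite eqxx orbT | case: eqP => [_|_ /= /IH ->];
  rewrite ?eqxx ?orbT].
Qed.

Lemma partnerK es : uniq (ends es) -> {in ends es, involutive (partner es)}.
Proof.
elim: es => [|[a b] es IH] //=; rewrite /ends /= -/(ends es) !inE negb_or.
move=> /andP[/andP[ab aes] /andP[bes ues]] x; rewrite !inE.
case: (x =P a) => [-> _|_]; first by rewrite eqxx eq_sym (negbTE ab).
case: (x =P b) => [-> _|_ /= xes]; first by rewrite eqxx.
(* The partner found in the tail is again an end of the tail, so it differs from [a] and [b] and the
   second lookup skips the head too. *)
have pes := partner_mem xes.
rewrite (negbTE (memPn aes _ pes)) (negbTE (memPn bes _ pes)).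
exact: IH.
Qed.

Lemma partner_edge es x y :
  uniq (ends es) -> (x, y) \in es -> partner es x = y.
Proof.
elim: es => [|[a b] es IH] //=; rewrite /ends /= -/(ends es) !inE negb_or.
move=> /andP[/andP[ab aes] /andP[bes ues]].
case: eqP => [[-> ->] _|_ /= xy]; first by rewrite eqxx.
have xes : x \in ends es.
  by apply/flatten_mapP; exists (x, y); rewrite ?inE ?eqxx.
by rewrite (negbTE (memPn aes _ xes)) (negbTE (memPn bes _ xes)) IH.
Qed.

Lemma partner_alternates c es : {in es, forall e, c e.2 = ~~ c e.1} ->
  {in ends es, forall x, c (partner es x) = ~~ c x}.
Proof.
elim: es => [|[a b] es IH] //= alt x; rewrite /ends /= -/(ends es) !inE.
have /= cab := alt (a, b) (mem_head _ _).
case: eqP => [->|_] //; case: eqP => [->|_ /=]; first by rewrite cab negbK.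
by apply: IH => e ees; apply: alt; rewrite inE ees orbT.
Qed.

Fixpoint alternating c (b : bool) (s : seq T) : bool :=
  if s is x :: s' then (c x == b) && alternating c (~~ b) s' else true.

Lemma alternating_cat c b s1 s2 : alternating c b (s1 ++ s2) =
  alternating c b s1 && alternating c (b (+) odd (size s1)) s2.
Proof.
elim: s1 b => [|x s1 IH] b /=; first by rewrite addbF.
by rewrite IH andbA addNb addbN.
Qed.

End Matching.

(** * Darts and edges of a word *)

Section Words.
Implicit Types (u w : word) (s l r : seq wdart) (x y : wdart).

Lemma trace_cap t l r w : trace t (l ++ r) ((Cap, size l) :: w) =
  trace t.+1 (l ++ [:: (t, 0), (t, 1) & r]) w.
Proof. by rewrite /= addn0 take_size_cat // drop_size_cat. Qed.

Lemma trace_cup t l x y r w :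
  trace t (l ++ [:: x, y & r]) ((Cup, size l) :: w) =
  (x, y) :: trace t.+1 (l ++ r) w.
Proof.
rewrite /= take_size_cat // addnC -drop_drop drop_size_cat //= drop0.
by rewrite !nth_cat ltnn subnn ltnNge leqnSn subSnn.
Qed.

Lemma trace_classical k t l x y r w : k <> Virt ->
  trace t (l ++ [:: x, y & r]) ((Cross k, size l) :: w) =
  [:: (x, (t, 0)), (y, (t, 3)) & trace t.+1 (l ++ [:: (t, 1), (t, 2) & r]) w].
Proof.
move=> kV; rewrite /= take_size_cat // addnC -drop_drop drop_size_cat //= drop0.
by rewrite !nth_cat ltnn subnn ltnNge leqnSn subSnn; case: k kV.
Qed.

Lemma trace_virtual t l x y r w :
  trace t (l ++ [:: x, y & r]) ((Cross Virt, size l) :: w) =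
  trace t.+1 (l ++ [:: y, x & r]) w.
Proof.
rewrite /= take_size_cat // addnC -drop_drop drop_size_cat //= drop0.
by rewrite !nth_cat ltnn subnn ltnNge leqnSn subSnn.
Qed.

(** The four virtual crossings swap two adjacent bands as blocks, keeping the order of the two
    strands within each. *)
Lemma trace_band t j l x1 y1 x2 y2 r w : size l = 2 * j ->
  trace t (l ++ [:: x1, y1, x2, y2 & r]) (band_crossing j ++ w) =
  trace (t + 4) (l ++ [:: x2, y2, x1, y1 & r]) w.
Proof.
move=> lj; rewrite -[band_crossing j ++ w]/[:: (Cross Virt, (2 * j).+1),
  (Cross Virt, 2 * j), (Cross Virt, (2 * j).+2), (Cross Virt, (2 * j).+1) & w].
rewrite -lj addn4 -cat_rcons -(size_rcons l x1) trace_virtual cat_rcons.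
rewrite trace_virtual -2!cat_rcons size_rcons -(size_rcons l x2).
rewrite -(size_rcons _ x1) trace_virtual !cat_rcons -cat_rcons.
by rewrite size_rcons -(size_rcons l x2) trace_virtual cat_rcons.
Qed.

(** Every dart is pushed once as a pending strand or met once from above, and since no strand
    survives at the bottom, each pending one is used up. The prefix [u] keeps the letter numbers
    right during the induction. *)
Lemma perm_ends_trace u w s : run (size s) w = Some 0 ->
  perm_eq (ends (trace (size u) s w))
    (s ++ [seq (t, k) | t <- iota (size u) (size w),
                        k <- iota 0 (valence (wgen (u ++ w) t))]).
Proof.
elim: w u s => [|[g i] w IH] u s; first by case: s.
rewrite [run _ _]/=; case: ifP => // im rw.
pose R := [seq (t, k) | t <- iota (size u).+1 (size w),
                        k <- iota 0 (valence (wgen (u ++ (g, i) :: w) t))].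
have -> : [seq (t, k) | t <- iota (size u) (size ((g, i) :: w)),
                        k <- iota 0 (valence (wgen (u ++ (g, i) :: w) t))] =
    [seq (size u, k) | k <- iota 0 (valence g)] ++ R.
  have gE : wgen (u ++ (g, i) :: w) (size u) = g by rewrite /wgen nth_cat_size.
  by rewrite /R /= gE.
have IH' s' : size s' = size s - ins g + outs g ->
    perm_eq (ends (trace (size u).+1 s' w)) (s' ++ R).
  move=> e; rewrite /R -cat_rcons -(size_rcons u (g, i)).
  by apply: IH; rewrite e.
(* Comparing counts for an arbitrary predicate turns each case into linear arithmetic. *)
move: R IH' => R IH'; apply/seq.permP => P.
case: g im rw IH' => [||k] im rw IH'; rewrite /= in im rw IH'.
- have [l [r [sE lE]]] : exists l r, s = l ++ r /\ size l = i.
    by exists (take i s), (drop i s);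
      rewrite cat_take_drop size_takel // -(addn0 i).
  rewrite sE -lE trace_cap (seq.permP (IH' _ _)); last first.
    by rewrite sE !size_cat /=; lia.
  by rewrite !count_cat /=; lia.
- have [l [x [y [r [sE lE]]]]] := split2 im.
  rewrite sE -lE trace_cup [ends _]/= /= (seq.permP (IH' _ _)); last first.
    by rewrite sE !size_cat /=; lia.
  by rewrite !count_cat /=; lia.
- have [l [x [y [r [sE lE]]]]] := split2 im.
  have [->|kV] : k = Virt \/ k <> Virt by case: k; [right | right | left].
    rewrite sE -lE trace_virtual (seq.permP (IH' _ _));
      last by rewrite sE !size_cat /=; lia.
    by rewrite !count_cat /=; lia.
  have -> : valence (Cross k) = 4 by case: k kV.
  rewrite sE -lE trace_classical // [ends _]/= /=.
  rewrite (seq.permP (IH' _ _)); last first.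
    by rewrite sE !size_cat /=; lia.
  by rewrite !count_cat /=; lia.
Qed.

Lemma perm_wedges (D : vdiagram) : perm_eq (ends (wedges D)) (wdarts D).
Proof. exact: (@perm_ends_trace [::] D [::] (vword_closed D)). Qed.

Lemma wdarts_uniq w : uniq (wdarts w).
Proof.
by apply: allpairs_uniq_dep => [|t _|[t k] [t' k'] _ _ [-> ->]] //;
  rewrite iota_uniq.
Qed.

Lemma mem_wdarts w t k :
  ((t, k) \in wdarts w) = (t < size w) && (k < valence (wgen w t)).
Proof.
apply/allpairsPdep/andP => [[t' [k' []]]|[tw kv]].
  by rewrite !mem_iota => /andP[_ tw] /andP[_ kv] [-> ->].
by exists t, k; rewrite !mem_iota.
Qed.

Lemma wnode_mem w d : d \in wdarts w -> wnode w d \in wdarts w.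
Proof.
case: d => t k; rewrite /wnode !mem_wdarts /= => /andP[-> kv].
by rewrite ltn_mod (leq_ltn_trans _ kv).
Qed.

(** A letter with darts has valence 2 or 4, and both divide 4. *)
Lemma wnode4 w : {in wdarts w, forall d, iter 4 (wnode w) d = d}.
Proof.
move=> [t k]; rewrite mem_wdarts /= /wnode /=.
by case: (wgen w t) => [||[]] /=; rewrite ?andbF // => /andP[_];
  move: k; do 4?case=> //.
Qed.

Lemma wnode_neq w : {in wdarts w, forall d, wnode w d != d}.
Proof.
move=> [t k]; rewrite mem_wdarts /= /wnode /= xpair_eqE eqxx /=.
by case: (wgen w t) => [||[]] /=; rewrite ?andbF // => /andP[_];
  move: k; do 4?case=> //.
Qed.

Lemma wover_wnode w : {in wdarts w, forall d,
  wnode w (wnode w d) != d -> wover w (wnode w d) = ~~ wover w d}.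
Proof.
move=> [t k]; rewrite mem_wdarts /wover /wnode /= xpair_eqE eqxx /=.
by case: (wgen w t) => [||[]] /=; rewrite ?andbF // => /andP[_];
  move: k; do 4?case=> //.
Qed.

End Words.

(** * The surface built from an alternating colouring *)

Section AlternatingDiagram.
Variables (D : vdiagram) (c : wdart -> bool) (d0 : wdart).
Hypothesis d0D : d0 \in wdarts D.
Hypothesis c_wnode : {in wdarts D, forall d, c (wnode D d) = ~~ c d}.
Hypothesis c_wedges : {in wedges D, forall e, c e.2 = ~~ c e.1}.

Let dartT : finType := seq_sub (wdarts D).

Let dart_val (d : dartT) : val d \in ends (wedges D).
Proof. by rewrite (perm_mem (perm_wedges D)); apply: valP. Qed.

Let ends_uniq : uniq (ends (wedges D)).
Proof. by rewrite (perm_uniq (perm_wedges D)) wdarts_uniq. Qed.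

Let edge_mem (d : dartT) : partner (wedges D) (val d) \in wdarts D.
Proof. by rewrite -(perm_mem (perm_wedges D)) partner_mem. Qed.

Let edgeT (d : dartT) : dartT := SeqSub (edge_mem d).
Let nodeT (d : dartT) : dartT := SeqSub (wnode_mem (valP d)).

Let c_edgeT d : c (val (edgeT d)) = ~~ c (val d).
Proof. exact: (partner_alternates c_wedges). Qed.

Let edgeTK : involutive edgeT.
Proof. by move=> d; apply: val_inj; apply: partnerK. Qed.

Let edgeT_neq d : edgeT d != d.
Proof.
by apply/eqP => e; have := c_edgeT d; rewrite e; case: (c _).
Qed.

Let nodeT4 d : iter 4 nodeT d = d.
Proof. by apply: val_inj; apply: wnode4 (valP d). Qed.

Let nodeT_neq d : nodeT d != d.
Proof. by rewrite -val_eqE; apply: wnode_neq (valP d). Qed.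

Let overT_node d : nodeT (nodeT d) != d ->
  wover D (val (nodeT d)) = ~~ wover D (val d).
Proof. by rewrite -val_eqE; apply: wover_wnode (valP d). Qed.

(** The colour can serve as the region: turning at the vertex and crossing the edge flip it once
    each. *)
Let sideT_edge d : c (val (edgeT (nodeT d))) = c (val d).
Proof. by rewrite c_edgeT /= c_wnode ?negbK //; apply: valP. Qed.

(* One region per colour: all boundary circles of a colour bound the same
   surface, here of genus 0. *)
Let alternating_surface : surface_diagram :=
  @SurfaceDiagram dartT edgeT edgeTK edgeT_neq nodeT nodeT4 nodeT_neq
    (fun d => wover D (val d)) overT_node bool (fun d => c (val d)) sideT_edge
    (fun=> 0).

Lemma alternating_checkerboard_colorable : checkerboard_colorable D.
Proof.
exists alternating_surface; last first.
  by exists id => d; rewrite /= c_edgeT; case: (c _).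
(* The surface diagram is immersed as [D] itself, and [f] is the identity on darts; [d0] is the
   default value elsewhere. *)
exists D; first exact: Relation_Operators.rst_refl.
pose f x : dartT := insubd (SeqSub d0D) x.
have fK x : x \in wdarts D -> val (f x) = x by move=> xD; rewrite insubdK.
exists f; split=> [x y xD yD e|d|x xD|x xD _|x y xy].
- by rewrite -(fK x) // e fK.
- by exists (val d); [apply: valP | apply: val_inj; rewrite fK //; apply: valP].
- by apply: val_inj; rewrite /= !fK ?wnode_mem.
- by rewrite /= fK.
have xD : x \in wdarts D.
  by rewrite -(perm_mem (perm_wedges D)); apply/flatten_mapP;
    exists (x, y); rewrite ?inE ?eqxx.
have yD : y \in wdarts D.
  by rewrite -(perm_mem (perm_wedges D)); apply/flatten_mapP;
    exists (x, y); rewrite ?inE ?eqxx ?orbT.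
by apply: val_inj; rewrite /= !fK //; apply: partner_edge.
Qed.

End AlternatingDiagram.

(** * Alternation along the edges of a banded word *)

Definition classical (g : gen) := if g is Cross Virt then false else true.

(** Virtual crossings come only in whole band crossings, since a single one would break the parity
    rule. *)
Inductive banded : word -> Prop :=
| banded_nil : banded [::]
| banded_cons g i w : classical g -> banded w -> banded ((g, i) :: w)
| banded_band j w : banded w -> banded (band_crossing j ++ w).

Lemma banded_cat w1 w2 : banded w1 -> banded w2 -> banded (w1 ++ w2).
Proof.
move=> b1 b2; elim: b1 => [|g i w cg _ IH|j w _ IH] //.
  exact: banded_cons.
by rewrite -catA; apply: banded_band.
Qed.

Lemma banded_classical w : all (fun x => classical x.1) w -> banded w.
Proof.
elim: w => [|[g i] w IH] /=; first by move=> _; apply: banded_nil.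
by move=> /andP[cg /IH]; apply: banded_cons.
Qed.

Lemma classical_top_word T : all (fun x => classical x.1) (top_word T).
Proof.
rewrite /top_word /=; elim: T 1 => //= l IHl r IHr i.
by rewrite all_cat IHl IHr.
Qed.

Lemma classical_flip w : all (fun x => classical x.1) w ->
  all (fun x => classical x.1) (flip w).
Proof.
rewrite /flip all_rev all_map; apply: sub_all => -[g i] /=.
by case: g => [||[]].
Qed.

Lemma banded_route j s : banded (route j s).
Proof.
elim: s j => [|x s IH] j /=; first exact: banded_nil.
apply: banded_cat; first exact: IH.
elim: (iota _ _) => [|k ks IHk]; first exact: banded_nil.
exact: banded_band.
Qed.

Lemma banded_LV t : banded (LV t).
Proof.
apply: banded_cat; first exact/banded_classical/classical_top_word.
apply: banded_cat; first exact: banded_route.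
exact/banded_classical/classical_flip/classical_top_word.
Qed.

(* [true] iff the region to the left of the dart, looking away from its vertex,
   is unshaded: this is [odd p] for a dart leaving downwards at the position
   [p], and [~~ odd p] for one leaving upwards. *)
Definition colour (w : word) (d : wdart) : bool :=
  let: (g, i) := nth (Cup, 0) w d.1 in
  odd d.2 (+) odd i (+) (if g is Cross _ then true else false).

(** All valences are even, so the parity of the dart number alternates even where the numbering
    wraps around. *)
Lemma colour_wnode w :
  {in wdarts w, forall d, colour w (wnode w d) = ~~ colour w d}.
Proof.
move=> [t k]; rewrite mem_wdarts /colour /wnode /wgen /=.
case: (nth _ w t) => [[||[]] i] /=; rewrite ?andbF // => /andP[_];
  by move: k; do 4?case=> //=; case: (odd i).
Qed.

(** The invariant is that the strand at position [p], counted from 0, comes from a dart of colour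
    [odd p]. A cup joins positions of opposite parity, and an upper dart of a crossing at [p] has
    colour [~~ odd p]. *)
Lemma trace_alternating u w s : banded w -> run (size s) w = Some 0 ->
  alternating (colour (u ++ w)) false s ->
  {in trace (size u) s w, forall e,
    colour (u ++ w) e.2 = ~~ colour (u ++ w) e.1}.
Proof.
move=> bw; elim: bw u s => {w} [|g i w cg _ IH|j w _ IH] u s //.
- rewrite [run _ _]/=; case: ifP => // im rw.
  have cE k : colour (u ++ (g, i) :: w) (size u, k) =
      odd k (+) odd i (+) (if g is Cross _ then true else false).
    by rewrite /colour nth_cat_size.
  have IH' s' : size s' = size s - ins g + outs g ->
      alternating (colour (u ++ (g, i) :: w)) false s' ->
      {in trace (size u).+1 s' w, forall e,
        colour (u ++ (g, i) :: w) e.2 = ~~ colour (u ++ (g, i) :: w) e.1}.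
    by move=> e; rewrite -cat_rcons -(size_rcons u (g, i)); apply: IH; rewrite e.
  move: (colour _) cE IH' => c cE IH' {IH}.
  case: g cg im rw cE IH' => [||k] cg im rw cE IH'; rewrite /= in im rw IH'.
  + have [l [r [sE lE]]] : exists l r, s = l ++ r /\ size l = i.
      by exists (take i s), (drop i s);
      rewrite cat_take_drop size_takel // -(addn0 i).
    rewrite sE -lE alternating_cat => /andP[al ar].
    rewrite trace_cap; apply: IH'; first by rewrite sE !size_cat /=; lia.
    by rewrite alternating_cat al /= negbK ar !cE lE; case: (odd i).
  + have [l [x [y [r [sE lE]]]]] := split2 im.
    rewrite sE -lE trace_cup alternating_cat /= negbK.
    move=> /and4P[al /eqP cx /eqP cy ar] e.
    rewrite inE => /orP[/eqP -> /=|]; first by rewrite cy cx.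
    apply: IH'; first by rewrite sE !size_cat /=; lia.
    by rewrite alternating_cat al.
  + have [l [x [y [r [sE lE]]]]] := split2 im.
    rewrite sE -lE trace_classical; last by move=> kV; rewrite kV in cg.
    rewrite alternating_cat /= negbK.
    move=> /and4P[al /eqP cx /eqP cy ar] e.
    rewrite !inE => /or3P[/eqP -> /=|/eqP -> /=|].
    * by rewrite cE cx lE; case: (odd i).
    * by rewrite cE cy lE; case: (odd i).
    apply: IH'; first by rewrite sE !size_cat /=; lia.
    by rewrite alternating_cat al /= negbK ar !cE lE; case: (odd i).
- rewrite run_cat => rw.
  (* The third letter of the band crossing sits at [2 * j + 2], so it requires [2 * j + 4]
     strands. *)
  have jm : 2 * j.+2 <= size s.
    by move: rw; rewrite /band_crossing /=; do 3![case: ifP => // ?]; lia.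
  move: rw; rewrite run_band // [obind _ _]/= => rw.
  have [|l [x1 [y1 [r' [sE lE]]]]] := @split2 _ s (2 * j); first by lia.
  have [|l' [x2 [y2 [r [r'E l'0]]]]] := @split2 _ r' 0.
    by move: jm; rewrite sE size_cat lE /=; lia.
  move: r'E; rewrite (size0nil l'0) cat0s {l' l'0} => r'E; rewrite {}r'E in sE.
  rewrite sE trace_band // alternating_cat [alternating _ _ (_ :: _)]/= !negbK.
  move=> /andP[al /and5P[e1 e2 e3 e4 ar]].
  rewrite catA -[size u + 4]/(size u + size (band_crossing j)).
  rewrite -size_cat; apply: IH.
    by rewrite -rw sE !size_cat.
  (* Both bands carry the same pair of colours, so swapping them preserves the invariant. *)
  rewrite -catA alternating_cat al [alternating _ _ (_ :: _)]/= !negbK.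
  by rewrite e1 e2 e3 e4.
Qed.

Theorem lemma3p1p1 (R : realType) (v : thompsonV R) (t : triple)
    (ht : is_reduced_triple_of t v) :
  checkerboard_colorable (LV t).
Proof.
apply: (@alternating_checkerboard_colorable _ (colour (LV t)) (0, 0)).
(* Letter 0 is the [Cap] at the root of the top tree; [(0, 0)] is its left leg. *)
- by rewrite mem_wdarts.
- exact: colour_wnode.
- exact: (@trace_alternating [::] _ [::] (banded_LV t) (vword_closed _)).
Qed.
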